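(* Let $m$ be a positive integer and $a,b$ complex numbers. Let $f_m(z,a,b)=\sum_{n\ge0}c(n,m,a,b)z^n$ be the unique formal power series with $f_m=1+azf_m+bz^mf_m^2$, and let $g(n,m,a,b)$ be defined by $\sum_{n\ge0}g(n,m,a,b)z^n=\frac{1}{\sqrt{(1-az)^2-4bz^m}}$. Put $d_k^{(m)}(N,a,b)=\det\big(c(i+j+k,m,a,b)\big)_{i,j=0}^{N-1}$ and $dd_k^{(m)}(N,a,b)=\det\big(g(i+j+k,m,a,b)\big)_{i,j=0}^{N-1}$. Then for every integer $n\ge0$: $d_0^{(m)}(mn+k,a,b)=0$ for $2\le k\le m-1$; $d_1^{(m)}(mn+k,a,b)=0$ for $2\le k\le m-2$; $d_2^{(m)}(mn+k,a,b)=0$ for $2\le k\le m-3$. The same vanishing statements hold with $d_j^{(m)}$ replaced by $dd_j^{(m)}$ ($j=0,1,2$).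
   Context: The power series $\frac{1}{\sqrt{(1-az)^2-4bz^m}}$ is the formal power series with constant term $1$. *)

(* Defs.v *)
From HB Require Import structures.
From mathcomp Require Import all_boot all_order all_algebra.
From mathcomp Require Import boolp reals ring.
From mathcomp Require Export complex.

Set Implicit Arguments.
Unset Strict Implicit.
Unset Printing Implicit Defensive.

Import GRing.Theory.
Local Open Scope ring_scope.

(* Formal power series over R; [coefs f n] is the coefficient of z^n.  The
   record keeps the ring structure (Cauchy product) apart from the pointwise
   one that function types may carry. *)
Record fps (R : Type) := Fps { coefs : nat -> R }.

HB.instance Definition _ (R : Type) := gen_eqMixin (fps R).
HB.instance Definition _ (R : Type) := gen_choiceMixin (fps R).

Lemma fpsP (R : Type) (f g : fps R) : coefs f =1 coefs g -> f = g.
Proof. by case: f g => [f] [g] /= /funext ->. Qed.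

Section FpsRing.
Variable R : comNzRingType.
Implicit Types f g h : fps R.

Definition fps_zero : fps R := Fps (fun=> 0).
Definition fps_opp f : fps R := Fps (fun n => - coefs f n).
Definition fps_add f g : fps R := Fps (fun n => coefs f n + coefs g n).

Definition fpsC (a : R) : fps R := Fps (fun n => if n == 0%N then a else 0).
Definition fpsX : fps R := Fps (fun n => (n == 1%N)%:R).
Definition fps_mul f g : fps R :=
  Fps (fun n => \sum_(i < n.+1) coefs f i * coefs g (n - i)%N).

Fact fps_addA : associative fps_add.
Proof. by move=> f g h; apply: fpsP => n /=; rewrite addrA. Qed.
Fact fps_addC : commutative fps_add.
Proof. by move=> f g; apply: fpsP => n /=; rewrite addrC. Qed.
Fact fps_add0 : left_id fps_zero fps_add.
Proof. by move=> f; apply: fpsP => n /=; rewrite add0r. Qed.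
Fact fps_addN : left_inverse fps_zero fps_opp fps_add.
Proof. by move=> f; apply: fpsP => n /=; rewrite addNr. Qed.

HB.instance Definition _ :=
  GRing.isZmodule.Build (fps R) fps_addA fps_addC fps_add0 fps_addN.

Definition fps_trunc N f : {poly R} := \poly_(i < N) coefs f i.

Lemma coef_trunc N f n : (n < N)%N -> (fps_trunc N f)`_n = coefs f n.
Proof. by move=> nN; rewrite coef_poly nN. Qed.

Lemma coef_fps_mul N f g n :
  (n < N)%N -> coefs (fps_mul f g) n = (fps_trunc N f * fps_trunc N g)`_n.
Proof.
move=> nN; rewrite coefM /=; apply: eq_bigr => i _.
have iN : (i < N)%N by apply: leq_ltn_trans nN; rewrite -ltnS.
by rewrite !coef_trunc // (leq_ltn_trans (leq_subr _ _) nN).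
Qed.

Fact fps_mulA : associative fps_mul.
Proof.
move=> f g h; apply: fpsP => n.
transitivity ((fps_trunc n.+1 f * (fps_trunc n.+1 g * fps_trunc n.+1 h))`_n).
  rewrite coefM; apply: eq_bigr => i _.
  by rewrite coef_trunc // (@coef_fps_mul n.+1) // ltnS leq_subr.
rewrite mulrA coefM; apply: eq_bigr => i _.
by rewrite coef_trunc ?ltnS ?leq_subr // -(@coef_fps_mul n.+1).
Qed.
Fact fps_mulC : commutative fps_mul.
Proof.
by move=> f g; apply: fpsP => n; rewrite !(@coef_fps_mul n.+1) // mulrC.
Qed.
Fact fps_mul1 : left_id (fpsC 1) fps_mul.
Proof.
move=> f; apply: fpsP => n /=; rewrite big_ord_recl /= mul1r subn0.
by rewrite big1 ?addr0 // => i _; rewrite mul0r.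
Qed.
Fact fps_mulD : left_distributive fps_mul fps_add.
Proof.
move=> f g h; apply: fpsP => n /=; rewrite -big_split /=.
by apply: eq_bigr => i _; rewrite mulrDl.
Qed.
Fact fps_1neq0 : fpsC 1 != 0.
Proof.
by apply/eqP => /(congr1 (fun f => coefs f 0)) /= /eqP; rewrite oner_eq0.
Qed.

HB.instance Definition _ := GRing.Zmodule_isComNzRing.Build (fps R)
  fps_mulA fps_mulC fps_mul1 fps_mulD fps_1neq0.

Lemma coefs0 n : coefs (0 : fps R) n = 0. Proof. by []. Qed.
Lemma coefs1 n : coefs (1 : fps R) n = if n == 0%N then 1 else 0.
Proof. by []. Qed.
Lemma coefsC a n : coefs (fpsC a) n = if n == 0%N then a else 0.
Proof. by []. Qed.
Lemma coefsD f g n : coefs (f + g) n = coefs f n + coefs g n.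
Proof. by []. Qed.
Lemma coefsN f n : coefs (- f) n = - coefs f n.
Proof. by []. Qed.
Lemma coefsM f g n :
  coefs (f * g) n = \sum_(i < n.+1) coefs f i * coefs g (n - i)%N.
Proof. by []. Qed.
Lemma coefsM0 f g : coefs (f * g) 0 = coefs f 0 * coefs g 0.
Proof. by rewrite coefsM big_ord1. Qed.

Lemma coefsCM a f n : coefs (fpsC a * f) n = a * coefs f n.
Proof.
rewrite coefsM big_ord_recl /= subn0 big1 ?addr0 // => i _; exact: mul0r.
Qed.

Lemma coefsXM f n : coefs (fpsX * f) n = if n is k.+1 then coefs f k else 0.
Proof.
case: n => [|n]; first by rewrite coefsM0 mul0r.
rewrite coefsM big_ord_recl mul0r add0r big_ord_recl /= mul1r subn1 /=.
by rewrite big1 ?addr0 // => i _; rewrite mul0r.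
Qed.

Lemma coefsXnM m f n :
  coefs (fpsX ^+ m * f) n = if (m <= n)%N then coefs f (n - m) else 0.
Proof.
elim: m n => [|m IH] n; first by rewrite expr0 mul1r subn0.
by rewrite exprS -mulrA coefsXM; case: n => [|n] //; rewrite IH subSS.
Qed.

End FpsRing.

Arguments fpsX {R}.

Section Existence.
Variable R : Type.

Lemma exists_causal (x0 : R) (F : nat -> (nat -> R) -> R) :
    (forall n u v, (forall i, (i < n)%N -> u i = v i) -> F n u = F n v) ->
  exists u : nat -> R, forall n, u n = F n u.
Proof.
move=> causF.
pose step s := rcons s (F (size s) (nth x0 s)).
pose L n := iter n step [::].
have szL n : size (L n) = n by elim: n => //= n IH; rewrite size_rcons IH.
have stab n i : (i < n)%N -> nth x0 (L n) i = nth x0 (L i.+1) i.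
  elim: n => // n IH; rewrite ltnS leq_eqVlt => /predU1P[-> //|lt_in].
  by rewrite /= nth_rcons szL lt_in; exact: IH.
exists (fun n => nth x0 (L n.+1) n) => n.
rewrite {1}/L /= -/(L n) nth_rcons szL ltnn eqxx.
by apply: causF => i /stab.
Qed.

End Existence.

Section Field.
Variable K : numFieldType.
Implicit Types f g s p : fps K.

Lemma fps_inv_ex f : coefs f 0 != 0 -> exists g, g * f = 1.
Proof.
move=> f0.
have [|u uE] := @exists_causal K 0 (fun n u => ((n == 0%N)%:R -
    \sum_(i < n) u i * coefs f (n - i)%N) / coefs f 0).
  move=> n u v uv; congr ((_ - _) / _).
  by apply: eq_bigr => i _; rewrite uv.
exists (Fps u); apply: fpsP => n.
rewrite coefsM coefs1 big_ord_recr /= subnn [u n]uE divfK // addrC subrK.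
by case: (n == 0%N).
Qed.

Lemma fps_mulIr0 f g : coefs f 0 != 0 -> g * f = 0 -> g = 0.
Proof.
move=> /fps_inv_ex[h hf] gf0.
by rewrite -[g]mulr1 -hf mulrCA gf0 mulr0.
Qed.

Lemma fps_sqrt_ex p : coefs p 0 = 1 -> exists2 s, coefs s 0 = 1 & s ^+ 2 = p.
Proof.
move=> p0.
have [|u uE] := @exists_causal K 0 (fun n u => if n is k.+1 then
    (coefs p n - \sum_(i < k) u i.+1 * u (k - i)%N) / 2 else 1).
  case=> // n u v uv; congr ((_ - _) / _); apply: eq_bigr => i _.
  by rewrite !uv // ltnS ?leq_subr // ltnW.
have u0 : u 0%N = 1 by rewrite uE.
exists (Fps u) => //; apply: fpsP => -[|n].
  by rewrite expr2 coefsM0 /= u0 mul1r p0.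
rewrite expr2 coefsM big_ord_recl big_ord_recr /= subn0 subnn u0 mulr1 mul1r.
under eq_bigr do rewrite /bump /= add1n subSS.
rewrite addrCA -mulr2n -mulr_natr [u n.+1]uE divfK ?Num.Theory.pnatr_eq0 //.
by rewrite addrC subrK.
Qed.

(* g = 1/sqrt(p): the sign of the root s is fixed by the constant term of g. *)
Definition is_inv_sqrt p g : Prop :=
  coefs g 0 = 1 /\ exists2 s, s ^+ 2 = p & g * s = 1.

Lemma is_inv_sqrt_ex p : coefs p 0 = 1 -> exists g, is_inv_sqrt p g.
Proof.
move=> /fps_sqrt_ex[s s0 sp].
have [|g gs] := @fps_inv_ex s; first by rewrite s0 oner_eq0.
exists g; split; last by exists s.
by move: (congr1 (fun f => coefs f 0) gs); rewrite coefsM0 s0 mulr1.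
Qed.

Lemma is_inv_sqrt_uniq p g g' : is_inv_sqrt p g -> is_inv_sqrt p g' -> g = g'.
Proof.
move=> [g0 [s sp gs]] [g'0 [s' s'p g's']].
have gp : g ^+ 2 * p = 1 by rewrite -sp -exprMn gs expr1n.
have g'p : g' ^+ 2 * p = 1 by rewrite -s'p -exprMn g's' expr1n.
have gg' : g ^+ 2 = g' ^+ 2.
  by rewrite -[LHS]mulr1 -g'p mulrCA gp mulr1.
apply/eqP; rewrite -subr_eq0; apply/eqP.
apply: (@fps_mulIr0 (g + g')); last by rewrite -subr_sqr gg' subrr.
by rewrite coefsD g0 g'0 -mulr2n Num.Theory.pnatr_eq0.
Qed.

Lemma gm_ex m (a b : K) : (0 < m)%N ->
  exists g, is_inv_sqrt
    ((1 - fpsC a * fpsX) ^+ 2 - 4 * fpsC b * fpsX ^+ m) g.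
Proof.
case: m => // m _; apply: is_inv_sqrt_ex.
rewrite coefsD coefsN expr2 exprS !coefsM0 coefsD coefsN coefsM0 /=.
by rewrite !(mulr0, mul0r) !subr0 mulr1.
Qed.

Lemma fm_ex m (a b : K) : (0 < m)%N ->
  exists f, f = 1 + fpsC a * fpsX * f + fpsC b * fpsX ^+ m * f ^+ 2.
Proof.
move=> m0.
have [|u uE] := @exists_causal K 0 (fun n u =>
   (if n == 0%N then 1 else 0) + a * (if n is k.+1 then u k else 0) +
   b * (if (m <= n)%N then
          \sum_(i < (n - m).+1) u i * u (n - m - i)%N else 0)).
  move=> n u v uv; congr (_ + a * _ + b * _); first by case: n uv => // n ->.
  case: ifP => // mn; apply: eq_bigr => i _.
  have lt_nm : (n - m < n)%N by rewrite ltn_subrL m0 (leq_trans m0 mn).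
  rewrite !uv //; first exact: leq_ltn_trans (leq_subr _ _) lt_nm.
  by apply: leq_ltn_trans lt_nm; rewrite -ltnS.
exists (Fps u); apply: fpsP => n.
rewrite !coefsD coefs1 -!mulrA !coefsCM coefsXM coefsXnM expr2 coefsM.
exact: uE.
Qed.

Lemma fm_uniq m (a b : K) f f' : (0 < m)%N ->
  f = 1 + fpsC a * fpsX * f + fpsC b * fpsX ^+ m * f ^+ 2 ->
  f' = 1 + fpsC a * fpsX * f' + fpsC b * fpsX ^+ m * f' ^+ 2 -> f = f'.
Proof.
move=> m0 fE f'E; apply/eqP; rewrite -subr_eq0; apply/eqP.
apply: (@fps_mulIr0
  (1 - fpsC a * fpsX - fpsC b * fpsX ^+ m * (f + f'))).
  case: m m0 {fE f'E} => // m _; rewrite !coefsD !coefsN exprS !coefsM0 /=.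
  by rewrite mulr0 !(mul0r, mulr0) !subr0 oner_eq0.
transitivity ((f - (1 + fpsC a * fpsX * f + fpsC b * fpsX ^+ m * f ^+ 2)) -
  (f' - (1 + fpsC a * fpsX * f' + fpsC b * fpsX ^+ m * f' ^+ 2))).
  by ring.
by rewrite -fE -f'E !subrr.
Qed.

End Field.

Definition hankel_det (R : comNzRingType) (u : nat -> R) (k N : nat) : R :=
  \det (\matrix_(i < N, j < N) u (i + j + k)%N).

(* Main.v *)
Require Import Defs.
From mathcomp Require Import all_boot all_order all_algebra.
From mathcomp Require Import reals.
From mathcomp Require Import zify ring.

Set Implicit Arguments.
Unset Strict Implicit.
Unset Printing Implicit Defensive.

Import GRing.Theory.
Local Open Scope ring_scope.

(** A Hankel determinant of order [N] of a series [F] vanishes as soon as [F] has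
    an unexpectedly good Pade approximant, i.e. polynomials [V != 0] and [P] of
    small degree with [V F - P] divisible by a large power of [z].  Put
    [A = 1 - a z] and [B = b z^m].  The root [beta = B f] of [x^2 - A x + B] is
    divisible by [z^m], so the Lucas sequences attached to [x^2 - A x + B] provide
    such approximants for both series: with [Q_0 = 0], [Q_1 = 1] and [L_0 = 2],
    [L_1 = A] one has [Q_(j+1) f - Q_j = f beta^j] and [L_j g - Q_j = 2 g beta^j].
    For [j = 2 n + 1] the denominators [Q_(j+1)], [L_j] have degree only
    [m n + 1], while the error is divisible by [z^(m (2 n + 1))]. *)

Section Degree.
Variable K : comNzRingType.
Implicit Types f g : fps K.

Definition fps_deg_le (d : nat) f : Prop :=
  forall i, (d < i)%N -> coefs f i = 0.

Lemma fps_deg_leW d e f : (d <= e)%N -> fps_deg_le d f -> fps_deg_le e f.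
Proof. by move=> de fd i ei; apply: fd; apply: leq_ltn_trans ei. Qed.

Lemma fps_deg_leC d c : fps_deg_le d (fpsC c : fps K).
Proof. by case. Qed.

Lemma fps_deg_leB d f g :
  fps_deg_le d f -> fps_deg_le d g -> fps_deg_le d (f - g).
Proof. by move=> fd gd i di; rewrite coefsD coefsN fd // gd // subr0. Qed.

Lemma fps_deg_leM d e f g :
  fps_deg_le d f -> fps_deg_le e g -> fps_deg_le (d + e) (f * g).
Proof.
move=> fd ge i dei; rewrite coefsM big1 // => j _.
have [dj|jd] := ltnP d j; first by rewrite fd // mul0r.
by rewrite ge ?mulr0 //; lia.
Qed.

Lemma fps_deg_leXn s : fps_deg_le s (fpsX ^+ s : fps K).
Proof.
move=> i si; rewrite -[_ ^+ _]mulr1 coefsXnM coefs1 (ltnW si).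
by rewrite subn_eq0 leqNgt si.
Qed.

Lemma fps_deg_le_monomial (b : K) m : fps_deg_le m (fpsC b * fpsX ^+ m).
Proof. exact: fps_deg_leM (@fps_deg_leC 0 b) (@fps_deg_leXn m). Qed.

Lemma coefs_linear0 (a : K) : coefs (1 - fpsC a * fpsX) 0 = 1.
Proof. by rewrite coefsD coefsN coefsM0 /= mulr0 subr0. Qed.

Lemma fps_deg_le_linear (a : K) : fps_deg_le 1 (1 - fpsC a * fpsX).
Proof.
apply: fps_deg_leB; first exact: fps_deg_leC.
by rewrite -[fpsX]expr1; exact: fps_deg_le_monomial.
Qed.

End Degree.

(** The reversed coefficients of [V] form a left null vector: its product with column [j] is the
    coefficient of [V * F] at [N.-1 + j + k], which lies past the terms of [P] and below [M]. *)
Lemma hankel_det_pade (K : fieldType) (F V P h : fps K) (k N M i : nat) :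
    (0 < N)%N -> (2 * N + k <= M.+1)%N ->
    fps_deg_le N.-1 V -> (forall j, (N + k <= j.+1)%N -> coefs P j = 0) ->
    coefs V i != 0 -> V * F = P + fpsX ^+ M * h ->
  hankel_det (coefs F) k N = 0.
Proof.
move=> N0 NM Vd Pd Vi VF; apply/eqP/det0P.
have iN : (i < N)%N.
  by rewrite ltnNge; apply: contraNN Vi => ?; rewrite Vd //; lia.
pose v : 'rV[K]_N := \row_(j < N) coefs V (N.-1 - j)%N.
exists v.
  apply: contraNneq Vi => v0.
  have jN : (N.-1 - i < N)%N by lia.
  have := congr1 (fun w : 'rV[K]_N => w 0 (Ordinal jN)) v0.
  by rewrite !mxE /= (_ : (N.-1 - (N.-1 - i) = i)%N) => [->|]; last lia.
apply/rowP => j; rewrite !mxE.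
have := congr1 (fun f => coefs f (N.-1 + j + k)%N) VF.
rewrite coefsD Pd ?add0r; last lia.
rewrite coefsXnM ifF; last by have := ltn_ord j; lia.
rewrite coefsM => VF0; rewrite -[RHS]VF0.
(* Only the first [N] terms of the Cauchy product survive, since [V] has degree below [N]. *)
have -> : ((N.-1 + j + k).+1 = N + (j + k))%N by lia.
rewrite big_split_ord /= [X in _ + X]big1 ?addr0; last first.
  by move=> r _; rewrite Vd ?mul0r //=; lia.
rewrite (reindex_inj rev_ord_inj); apply: eq_bigr => r _ /=.
rewrite !mxE /=; congr (coefs _ _ * coefs _ _); have := ltn_ord r; lia.
Qed.

Section LucasSequence.
Variable K : comNzRingType.
Implicit Types (A B beta F c : fps K) (u v : nat -> fps K).

(** The state is a pair of consecutive terms, so that [lucas_rec] holds by computation. *)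
Definition lucas_seq A B (u0 u1 : fps K) n : fps K :=
  (iter n (fun p => (p.2, A * p.2 - B * p.1)) (u0, u1)).1.

Definition lucas_rec A B u : Prop :=
  forall n, u n.+2 = A * u n.+1 - B * u n.

Lemma lucas_rec_uniq A B u v : lucas_rec A B u -> lucas_rec A B v ->
  u 0%N = v 0%N -> u 1%N = v 1%N -> u =1 v.
Proof.
move=> ru rv uv0 uv1 n.
suff [] : u n = v n /\ u n.+1 = v n.+1 by [].
by elim: n => // n [IH1 IH2]; split=> //; rewrite ru rv IH1 IH2.
Qed.

(** Both [u n * F - v n] and [c * beta ^+ n] satisfy the recurrence, the latter because [beta] is a
    root of x^2 - A x + B. *)
Lemma lucas_pade A B beta F c u v :
    beta ^+ 2 = A * beta - B -> lucas_rec A B u -> lucas_rec A B v ->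
    u 0%N * F - v 0%N = c -> u 1%N * F - v 1%N = c * beta ->
  forall n, u n * F = v n + c * beta ^+ n.
Proof.
move=> bE ru rv e0 e1 n; apply/eqP; rewrite addrC -subr_eq; apply/eqP.
apply: (@lucas_rec_uniq A B (fun n => u n * F - v n)
          (fun n => c * beta ^+ n)).
- by move=> i /=; rewrite ru rv; ring.
- by move=> i /=; rewrite -addn2 exprD bE exprS; ring.
- by rewrite mulr1.
- by rewrite expr1.
Qed.

Variables (m : nat) (a b : K).
Let A : fps K := 1 - fpsC a * fpsX.
Let B : fps K := fpsC b * fpsX ^+ m.

(** Two steps multiply by [B] once or by [A] twice; either way the degree grows by at most [m], as
    [2 <= m]. *)
Lemma lucas_deg u : (1 < m)%N -> lucas_rec A B u ->
    fps_deg_le 0 (u 0%N) -> fps_deg_le 1 (u 1%N) ->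
  forall n, fps_deg_le (m * n) (u n.*2) /\ fps_deg_le (m * n).+1 (u n.*2.+1).
Proof.
move=> m1 ru d0 d1; elim=> [|n [IH0 IH1]]; first by rewrite muln0.
have dA := @fps_deg_le_linear _ a; have dB := @fps_deg_le_monomial _ b m.
have IH2 : fps_deg_le (m * n.+1) (u n.+1.*2).
  rewrite doubleS ru; apply: fps_deg_leB.
    by apply: fps_deg_leW (fps_deg_leM dA IH1); nia.
  by apply: fps_deg_leW (fps_deg_leM dB IH0); nia.
split=> //; rewrite doubleS ru -doubleS; apply: fps_deg_leB.
  by apply: fps_deg_leW (fps_deg_leM dA IH2); nia.
by apply: fps_deg_leW (fps_deg_leM dB IH1); nia.
Qed.

Lemma lucas_coefs0 u : (0 < m)%N -> lucas_rec A B u ->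
  forall n, coefs (u n.+1) 0 = coefs (u 1%N) 0.
Proof.
move=> m0 ru; elim=> // n <-; rewrite ru coefsD coefsN !coefsM0 coefs_linear0.
case: m m0 => // p _; rewrite exprS coefsM0 /=.
by rewrite mul0r mulr0 mul0r subr0 mul1r.
Qed.

End LucasSequence.

Section HankelLucas.
Variables (K : fieldType) (m : nat) (a b : K).
Let A : fps K := 1 - fpsC a * fpsX.
Let B : fps K := fpsC b * fpsX ^+ m.

(** This serves both series: [F = f] with [c = 1], where [V] is Q_(j+1), and [F = g] with [c = 2],
    where [V] is L_j. *)
Lemma hankel_det_lucas (f F : fps K) (c : K) (n k s : nat) :
    f = 1 + fpsC a * fpsX * f + B * f ^+ 2 ->
    A * F - 1 = fpsC c * F * (B * f) ->
    (2 <= k)%N -> (k + s < m)%N ->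
  hankel_det (coefs F) s (m * n + k) = 0.
Proof.
move=> fE FE k2 ksm.
have Af : A * f = 1 + B * f ^+ 2 by rewrite /A mulrBl mul1r {1}fE; ring.
have BfX j : (B * f) ^+ j = fpsX ^+ (m * j) * (fpsC b * f) ^+ j.
  by rewrite exprM -exprMn mulrA [_ * fpsC b]mulrC.
pose V := lucas_seq A B (fpsC c) A; pose P := lucas_seq A B 0 1.
have VF j : V j * F = P j + fpsC c * F * (B * f) ^+ j.
  apply: (@lucas_pade _ A B) => //; last by rewrite subr0.
  have -> : A * (B * f) - B = B * (A * f) - B by ring.
  by rewrite Af; ring.
have m1 : (1 < m)%N by lia.
have rV : lucas_rec A B V by [].
have [_ dV] := lucas_deg m1 rV (@fps_deg_leC _ _ _)
                 (@fps_deg_le_linear _ _) n.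
(* After the shift, [P n.*2.+1] is a term of even index, of degree at most [m * n]; the bound
   [(m * n).+1] would be too weak for [s = 0]. *)
have rP : lucas_rec A B (fun j => P j.+1) by [].
have dP2 : fps_deg_le 1 (P 2%N).
  rewrite /P /lucas_seq /= mulr1 mulr0 subr0; exact: fps_deg_le_linear.
have [dP _] := lucas_deg m1 rP (@fps_deg_leC _ _ _) dP2 n.
(* The factor z^(k-2) raises the degree bound of [V] to [m * n + k - 1], one below the order of the
   determinant. The condition on the error order then reads [k + s < m]. *)
apply: (@hankel_det_pade _ F (fpsX ^+ (k - 2) * V n.*2.+1)
   (fpsX ^+ (k - 2) * P n.*2.+1)
   (fpsC c * F * (fpsC b * f) ^+ n.*2.+1)
   s _ (k - 2 + m * n.*2.+1) (k - 2)).
- lia.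
- nia.
- by apply: fps_deg_leW (fps_deg_leM (@fps_deg_leXn _ _) dV); lia.
- move=> j jN.
  by apply: (fps_deg_leM (@fps_deg_leXn _ (k - 2)) dP); lia.
- rewrite coefsXnM leqnn subnn (lucas_coefs0 (ltnW m1) rV).
  by rewrite coefs_linear0 oner_neq0.
- rewrite -mulrA VF BfX exprD.
  move: (P _) (_ ^+ n.*2.+1) (fpsX ^+ (m * _)) (fpsX ^+ _) => p x y z; ring.
Qed.

End HankelLucas.

(** The difference A - 2 B f of the two roots of x^2 - A x + B squares to the discriminant and has
    constant term 1, so its inverse is [g] by uniqueness. *)
Lemma inv_sqrt_root (K : numFieldType) (m : nat) (a b : K) (f g : fps K) :
    (0 < m)%N ->
    f = 1 + fpsC a * fpsX * f + fpsC b * fpsX ^+ m * f ^+ 2 ->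
    is_inv_sqrt ((1 - fpsC a * fpsX) ^+ 2 - 4 * fpsC b * fpsX ^+ m) g ->
  g * (1 - fpsC a * fpsX - 2 * (fpsC b * fpsX ^+ m * f)) = 1.
Proof.
set A := 1 - _; set B := fpsC b * _ => m0 fE gE.
have Af : A * f = 1 + B * f ^+ 2 by rewrite /A mulrBl mul1r {1}fE; ring.
pose t := A - 2 * (B * f).
have t0 : coefs t 0 = 1.
  rewrite coefsD coefsN coefs_linear0 !coefsM0.
  case: m m0 {B gE fE Af t} => // p _; rewrite exprS coefsM0 /=.
  by rewrite !(mul0r, mulr0) subr0.
have t2 : t ^+ 2 = A ^+ 2 - 4 * fpsC b * fpsX ^+ m.
  have -> : t ^+ 2 = A ^+ 2 - 4 * B * (A * f - B * f ^+ 2) by rewrite /t; ring.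
  by rewrite Af addrK mulr1 /B mulrA.
have [|h ht] := @fps_inv_ex _ t; first by rewrite t0 oner_neq0.
suff -> : g = h by [].
apply: is_inv_sqrt_uniq gE _; split; last by exists t.
by have := congr1 (fun x => coefs x 0) ht; rewrite coefsM0 t0 mulr1.
Qed.

Unset Implicit Arguments.

Theorem theorem5p1 (R : realType) (m : nat) (a b : R[i]) (f g : fps R[i])
    (hm : (0 < m)%N)
    (hf : f = 1 + fpsC a * fpsX * f + fpsC b * fpsX ^+ m * f ^+ 2)
    (hg : is_inv_sqrt
            ((1 - fpsC a * fpsX) ^+ 2 - 4 * fpsC b * fpsX ^+ m) g)
    (n k : nat) :
  [/\ (2 <= k <= m - 1)%N -> hankel_det (coefs f) 0 (m * n + k) = 0,
      (2 <= k <= m - 2)%N -> hankel_det (coefs f) 1 (m * n + k) = 0 &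
      (2 <= k <= m - 3)%N -> hankel_det (coefs f) 2 (m * n + k) = 0] /\
  [/\ (2 <= k <= m - 1)%N -> hankel_det (coefs g) 0 (m * n + k) = 0,
      (2 <= k <= m - 2)%N -> hankel_det (coefs g) 1 (m * n + k) = 0 &
      (2 <= k <= m - 3)%N -> hankel_det (coefs g) 2 (m * n + k) = 0].
Proof.
have f_case : (1 - fpsC a * fpsX) * f - 1 =
    fpsC 1 * f * (fpsC b * fpsX ^+ m * f).
  by rewrite [fpsC 1]/(1 : fps _) mulrBl mul1r {1}hf; ring.
have g_case : (1 - fpsC a * fpsX) * g - 1 =
    fpsC 2 * g * (fpsC b * fpsX ^+ m * f).
  have -> : fpsC 2 = 2 :> fps R[i].
    by apply: fpsP => -[|i]; rewrite /= ?addr0.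
  by rewrite -{2}(inv_sqrt_root hm hf hg); ring.
(* Subtraction on [nat] truncates at 0, but [2 <= k] excludes that case. *)
by split; split=> /andP[k2 km];
  (apply: hankel_det_lucas hf f_case _ _ || apply: hankel_det_lucas hf g_case _ _);
  lia.
Qed.
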